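(* Assume there exist a scalar $\varepsilon>0$, matrices $P_i\in\mathbb{S}^n_{+}$, $i=1,\ldots,N$, and symmetric matrix functions $Z_{ij}:[0,T_i^{\max}]\times[T_i^{\min},T_i^{\max}]\to\mathbb{S}^{3n}$, $i,j=1,\ldots,N$, $i\neq j$, differentiable with respect to the first variable and verifying $$Y_2^{T}Z_{ij}(T_i,T_i)Y_2-Y_1^{T}Z_{ij}(0,T_i)Y_1=0\quad\text{for all }T_i\in[T_i^{\min},T_i^{\max}],$$ where $$Y_1=\begin{bmatrix} I_n&0_n\\ I_n&0_n\\ 0_n&I_n\end{bmatrix},\quad Y_2=\begin{bmatrix}0_n&I_n\\ I_n&0_n\\ 0_n&I_n\end{bmatrix},$$ such that the LMIs $$\Psi_{ij}(T_i)+\mathrm{Sym}\left(Z_{ij}(\tau,T_i)\mathcal{D}_n(A_i)\right)+\frac{\partial Z_{ij}}{\partial\tau}(\tau,T_i)\preceq0,\quad i,j=1,\ldots,N,\ i\neq j,$$ hold for all $\tau\in[0,T_i]$ and all $T_i\in[T_i^{\min},T_i^{\max}]$, where $$\Psi_{ij}(T_i)=\begin{bmatrix}T_i(A_i^{T}P_i+P_iA_i)&0_n&0_n\\ 0_n&P_i-P_j+\varepsilon I_n&0_n\\ 0_n&0_n&0_n\end{bmatrix}.$$ Then the switched system $\dot x(t)=A_{\sigma(t)}x(t)$, $x(t_0)=x_0$, with mode-dependent dwell-times $T_i\in[T_i^{\min},T_i^{\max}]$, $i=1,\ldots,N$, is globally asymptotically stable; moreover, the same matrices $P_i$ satisfy,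 for all $i,j\in\{1,\ldots,N\}$ with $i\neq j$, $$e^{A_i^{T}T_i}P_i\,e^{A_iT_i}-P_j\prec0\quad\text{for all }T_i\in[T_i^{\min},T_i^{\max}].$$
   Context: $A_1,\ldots,A_N\in\mathbb{R}^{n\times n}$ are known real matrices. $\mathbb{S}^m$ is the set of symmetric real $m\times m$ matrices and $\mathbb{S}^m_+$ the set of positive definite ones; $A\succ B$ (resp. $A\succeq B$) means $A-B$ is positive definite (resp. positive semidefinite). For a square real matrix $M$, $\mathrm{Sym}(M)=M+M^T$. For $M\in\mathbb{R}^{n\times n}$, $\mathcal{D}_n(M)=\mathrm{diag}(M,0_n,0_n)\in\mathbb{R}^{3n\times 3n}$. $I_n$ and $0_n$ are the $n\times n$ identity and zero matrices; $\partial Z_{ij}/\partial\tau$ is the derivative with respect to the first variable. The switched system is $\dot x(t)=A_{\sigma(t)}x(t)$, $x(t_0)=x_0\in\mathbb{R}^n$, where the switching signal $\sigma:\mathbb{R}_+\to\{1,\ldots,N\}$ is piecewise constant. The switching instants $t_1<t_2<\cdots$ are the instants at which the mode changes (from some mode $j$ to some mode $i\neq j$); they are state-independent and have no accumulation point, i.e. $t_k\to\infty$ as $k\to\infty$. For each $i$, bounds satisfying $\epsilon<T_i^{\min}<T_i^{\max}<\infty$ for some $\epsilon>0$ are given. ''With mode-dependent dwell-times $T_i\in[T_i^{\min},T_i^{\max}]$'' means that each time the system enters mode $i$ it stays in mode $i$ for a duration $T_i$ lying in $[T_i^{\min},T_i^{\max}]$ (the duration may differ from one visit to another) before switching to a different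 mode. Stability refers to the equilibrium $x=0$, for every switching signal satisfying these constraints. *)

(* Defs.v *)
From HB Require Import structures.
From mathcomp Require Import all_boot all_order all_algebra.
From mathcomp Require Import all_classical all_reals all_analysis.

Set Implicit Arguments.
Unset Strict Implicit.
Unset Printing Implicit Defensive.

Import Order.TTheory GRing.Theory Num.Theory.
Import numFieldNormedType.Exports.

Local Open Scope classical_set_scope.
Local Open Scope ring_scope.

Definition posdefmx (R : realType) (m : nat) (M : 'M[R]_m) : Prop :=
  M^T = M /\ forall v : 'cV[R]_m, v != 0 -> 0 < (v^T *m M *m v) 0 0.

Definition possemidefmx (R : realType) (m : nat) (M : 'M[R]_m) : Prop :=
  M^T = M /\ forall v : 'cV[R]_m, 0 <= (v^T *m M *m v) 0 0.

Notation "A \prec B" := (posdefmx (B - A)) (at level 70, no associativity).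
Notation "A \preceq B" := (possemidefmx (B - A))
  (at level 70, no associativity).

Definition symsum (R : realType) (m : nat) (M : 'M[R]_m) : 'M[R]_m := M + M^T.

Definition expmx (R : realType) (n : nat) (M : 'M[R]_n) : 'M[R]_n :=
  limn (series (fun k : nat => (k`!%:R)^-1 *: M ^+ k)).

(* Differentiability relative to [D]: one-sided at the endpoints when [D] is a
   segment, so the values of [f] outside [D] are irrelevant. *)
Definition derivable_within (R : realType) (V : normedModType R) (D : set R)
    (f : R -> V) (x : R) : Prop :=
  cvg ((fun y : R => (y - x)^-1 *: (f y - f x)) @ within D x^').

Definition derive_within (R : realType) (V : normedModType R) (D : set R)
    (f : R -> V) (x : R) : V :=
  lim ((fun y : R => (y - x)^-1 *: (f y - f x)) @ within D x^').

(* Matrices of order 3n have order [n + (n + n)], which carries the 3 x 3 block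
   decomposition definitionally. *)
Definition diag3 (R : realType) (n : nat) (M1 M2 M3 : 'M[R]_n) :
    'M[R]_(n + (n + n)) :=
  block_mx M1 0 0 (block_mx M2 0 0 M3).

Definition Y1 (R : realType) (n : nat) : 'M[R]_(n + (n + n), n + n) :=
  col_mx (row_mx 1%:M 0) (col_mx (row_mx 1%:M 0) (row_mx 0 1%:M)).

Definition Y2 (R : realType) (n : nat) : 'M[R]_(n + (n + n), n + n) :=
  col_mx (row_mx 0 1%:M) (col_mx (row_mx 1%:M 0) (row_mx 0 1%:M)).

Definition Psi (R : realType) (n : nat) (Ai Pi Pj : 'M[R]_n) (eps T : R) :
    'M[R]_(n + (n + n)) :=
  diag3 (T *: (Ai^T *m Pi + Pi *m Ai)) (Pi - Pj + eps%:M) 0.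

(* [sigma] is only relevant on [0, +oo[; [s k] is the (k+1)-st switching instant
   and, by convention, the mode entered at [s k] is already active at [s k]. *)
Record switching_signal (R : realType) (N : nat) (sigma : R -> 'I_N)
    (s : nat -> R) : Prop := SwitchingSignal {
  switching_first_gt0 : 0 < s 0%N ;
  switching_increasing : forall k : nat, s k < s k.+1 ;
  switching_no_accumulation : s k @[k --> \oo] --> +oo ;
  switching_initial_mode :
    forall t : R, 0 <= t -> t < s 0%N -> sigma t = sigma 0 ;
  switching_mode : forall (k : nat) (t : R),
    s k <= t -> t < s k.+1 -> sigma t = sigma (s k) ;
  switching_initial_change : sigma (s 0%N) != sigma 0 ;
  switching_change : forall k : nat, sigma (s k.+1) != sigma (s k)
}.

(* The sojourn in the initial mode, which is not entered at a switching
   instant, is not constrained. *)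
Definition mode_dependent_dwell_times (R : realType) (N : nat)
    (Tmin Tmax : 'I_N -> R) (sigma : R -> 'I_N) (s : nat -> R) : Prop :=
  forall k : nat,
    Tmin (sigma (s k)) <= s k.+1 - s k /\ s k.+1 - s k <= Tmax (sigma (s k)).

Definition switched_solution (R : realType) (N n : nat) (A : 'I_N -> 'M[R]_n)
    (sigma : R -> 'I_N) (s : nat -> R) (t0 : R) (x : R -> 'cV[R]_n) : Prop :=
  {within `[t0, +oo[, continuous x} /\
  forall t : R, t0 < t -> (forall k : nat, t != s k) ->
    is_derive t (1 : R) x (A (sigma t) *m x t).

Definition stable (R : realType) (N n : nat) (A : 'I_N -> 'M[R]_n)
    (sigma : R -> 'I_N) (s : nat -> R) : Prop :=
  forall t0 : R, 0 <= t0 -> forall e : R, 0 < e ->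
  exists2 d : R, 0 < d & forall x : R -> 'cV[R]_n,
    switched_solution A sigma s t0 x -> `|x t0| < d ->
    forall t : R, t0 <= t -> `|x t| < e.

Definition globally_attractive (R : realType) (N n : nat)
    (A : 'I_N -> 'M[R]_n) (sigma : R -> 'I_N) (s : nat -> R) : Prop :=
  forall t0 : R, 0 <= t0 -> forall x : R -> 'cV[R]_n,
    switched_solution A sigma s t0 x -> x t @[t --> +oo] --> (0 : 'cV[R]_n).

Definition globally_asymptotically_stable (R : realType) (N n : nat)
    (A : 'I_N -> 'M[R]_n) (sigma : R -> 'I_N) (s : nat -> R) : Prop :=
  stable A sigma s /\ globally_attractive A sigma s.

(* Main.v *)
Require Import Defs.
From mathcomp Require Import all_boot all_order all_algebra.
From mathcomp Require Import all_classical all_reals all_analysis.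
From mathcomp Require Import ring lra.
Import Order.TTheory GRing.Theory Num.Theory.
Import numFieldNormedType.Exports.
Local Open Scope classical_set_scope.
Local Open Scope ring_scope.

Set Implicit Arguments.
Unset Strict Implicit.
Unset Printing Implicit Defensive.

(** Let [x] solve [x' = A_i x] between [0] and [T], with [T] an admissible dwell
time of mode [i], and put [xi t = (x t, x 0, x T)].  Then [xi' = diag3 (A_i) 0 0 * xi],
so the function
[[
  T * x^T P_i x + t * x(0)^T (P_i - P_j + eps) x(0) + xi^T Z_ij xi
]]
of [t] has derivative [xi^T (Psi + Sym (Z_ij D) + dZ_ij/dt) xi], which the
matrix inequality makes nonpositive.  Since [xi 0 = Y1 (x 0, x T)] and
[xi T = Y2 (x 0, x T)], the boundary condition on [Z_ij] says exactly that the
term in [Z_ij] takes the same value at both ends: the functional is looped.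
Comparing the two ends and dividing by [T] leaves
[[
  x(T)^T P_i x(T) <= x(0)^T P_j x(0) - eps |x(0)|^2,
]]
which is [dwell_decrease].  It holds for an arbitrary solution, hence along the
trajectories of the switched system as well as along matrix exponentials.

Applied to [x t = exp (t A_i) v], it is the strict inequality on matrix
exponentials ([expmx_sandwich_lt]); what has to be known about the exponential
is that it solves the matrix equation ([expmx_derives_on]), which follows entry
by entry from the termwise differentiation of power series.

For stability, let [V_k] be [x^T P x] at the [k]-th switching instant [s_k],
with [P] taken for the mode being left.  With [j] the mode left at [s_k] and
[i] the mode entered, the inequality reads [eps |x(s_k)|^2 <= V_k - V_(k+1)].
As [V] is nonnegative and nonincreasing, this bounds every [|x(s_k)|^2] by a
multiple of the first one, and, [V] being convergent, forces [x(s_k)] to tend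
to [0].  Between two switching instants [|x|^2] grows at most by a fixed factor
because dwell times are bounded ([sqnorm_growth]), so both properties extend
from the switching instants to all times ([leg_decrease_gas]). *)

(** * Differentiation on a compact interval *)

Section ScalarCalculus.
Variables (R : realType) (a b : R).
Implicit Types f g df dg : R -> R.

(** Continuity up to the endpoints with a derivative inside only: this is what
the mean value theorem asks for, and all that is known of a solution between two
switching instants. *)
Definition derives_on f df : Prop :=
  {within `[a, b], continuous f} /\
  forall t, t \in `]a, b[ -> is_derive t (1 : R) f (df t).

Lemma eq_derives_on f df df' :
  (forall t, t \in `]a, b[ -> df t = df' t) ->
  derives_on f df -> derives_on f df'.
Proof. by move=> e [cf f1]; split=> // t tab; rewrite -e//; exact: f1. Qed.

Lemma derives_on_everywhere f df :
  (forall t, is_derive t (1 : R) f (df t)) -> derives_on f df.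
Proof.
move=> f1; split=> [|t _]; last exact: f1.
apply: continuous_subspaceT => t.
by apply/differentiable_continuous/derivable1_diffP; case: (f1 t).
Qed.

Lemma derives_on_cst c : derives_on (fun=> c) (fun=> 0).
Proof. by apply: derives_on_everywhere => t; exact: is_derive_cst. Qed.

Lemma derives_onD f g df dg : derives_on f df -> derives_on g dg ->
  derives_on (fun t => f t + g t) (fun t => df t + dg t).
Proof.
move=> [cf f1] [cg g1]; split=> [t|t tab].
  exact: cvgD (cf t) (cg t).
by have := f1 t tab; have := g1 t tab => ? ?; exact: is_deriveD.
Qed.

Lemma derives_onM f g df dg : derives_on f df -> derives_on g dg ->
  derives_on (fun t => f t * g t) (fun t => df t * g t + f t * dg t).
Proof.
move=> [cf f1] [cg g1]; split=> [t|t tab].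
  exact: cvgM (cf t) (cg t).
have := f1 t tab; have := g1 t tab => ? ?.
by apply: (is_derive_eq (is_deriveM _ _)); rewrite /GRing.scale/= addrC mulrC.
Qed.

Lemma derives_on_sum (I : Type) (r : seq I) (F dF : I -> R -> R) :
  (forall i, derives_on (F i) (dF i)) ->
  derives_on (fun t => \sum_(i <- r) F i t) (fun t => \sum_(i <- r) dF i t).
Proof.
move=> Fd; elim: r => [|i r IH].
  under eq_fun do rewrite big_nil.
  under [X in derives_on _ X]eq_fun do rewrite big_nil.
  exact: derives_on_cst.
under eq_fun do rewrite big_cons.
under [X in derives_on _ X]eq_fun do rewrite big_cons.
exact: derives_onD.
Qed.

Lemma derives_on_nonincreasing f df : a <= b -> derives_on f df ->
  (forall t, t \in `]a, b[ -> df t <= 0) -> f b <= f a.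
Proof.
move=> ab [cf f1] df0; apply: (ler0_derive1_le_cc (a := a) (b := b)) => //.
- by move=> t tab; case: (f1 t tab).
- by move=> t tab; have [_] := f1 t tab; rewrite derive1E => ->; exact: df0.
- by rewrite bound_itvE.
- by rewrite bound_itvE.
Qed.

End ScalarCalculus.

Section MatrixCalculus.
Variables (R : realType) (a b : R).

(** Working entry by entry reduces the calculus of matrix products and blocks to
the scalar rules. *)
Definition mx_derives_on m p (F dF : R -> 'M[R]_(m, p)) : Prop :=
  forall i j, derives_on a b (fun t => F t i j) (fun t => dF t i j).

Lemma eq_mx_derives_on m p (F dF dF' : R -> 'M[R]_(m, p)) :
  (forall t, t \in `]a, b[ -> dF t = dF' t) ->
  mx_derives_on F dF -> mx_derives_on F dF'.
Proof.
by move=> e FdF i j; apply: eq_derives_on (FdF i j) => t tab; rewrite e.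
Qed.

Lemma mx_derives_on_cst m p (M : 'M[R]_(m, p)) :
  mx_derives_on (fun=> M) (fun=> 0).
Proof.
move=> i j; under [X in derives_on _ _ _ X]eq_fun do rewrite mxE.
exact: derives_on_cst.
Qed.

Lemma mx_derives_onM m p q (F dF : R -> 'M[R]_(m, p)) (G dG : R -> 'M[R]_(p, q)) :
  mx_derives_on F dF -> mx_derives_on G dG ->
  mx_derives_on (fun t => F t *m G t) (fun t => dF t *m G t + F t *m dG t).
Proof.
move=> FdF GdG i j; under eq_fun do rewrite mxE.
under [X in derives_on _ _ _ X]eq_fun do rewrite !mxE -big_split.
by apply: derives_on_sum => k; exact: derives_onM.
Qed.

Lemma mx_derives_on_tr m p (F dF : R -> 'M[R]_(m, p)) :
  mx_derives_on F dF -> mx_derives_on (fun t => (F t)^T) (fun t => (dF t)^T).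
Proof.
move=> FdF i j; under eq_fun do rewrite mxE.
by under [X in derives_on _ _ _ X]eq_fun do rewrite mxE; exact: FdF.
Qed.

Lemma mx_derives_on_col m1 m2 p (F dF : R -> 'M[R]_(m1, p))
    (G dG : R -> 'M[R]_(m2, p)) :
  mx_derives_on F dF -> mx_derives_on G dG ->
  mx_derives_on (fun t => col_mx (F t) (G t)) (fun t => col_mx (dF t) (dG t)).
Proof.
move=> FdF GdG i j; rewrite -(splitK i); case: (fintype.split i) => k /=.
  under eq_fun do rewrite col_mxEu.
  by under [X in derives_on _ _ _ X]eq_fun do rewrite col_mxEu.
under eq_fun do rewrite col_mxEd.
by under [X in derives_on _ _ _ X]eq_fun do rewrite col_mxEd.
Qed.

Lemma mx_derives_on_intro m p (F dF : R -> 'M[R]_(m, p)) :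
  {within `[a, b], continuous F} ->
  (forall t, t \in `]a, b[ -> is_derive t (1 : R) F (dF t)) ->
  mx_derives_on F dF.
Proof.
move=> cF F1 i j; split=> [t|t tab].
  exact: cvg_comp (cF t) (@coord_continuous _ _ _ i j _).
have [/[dup] dFt /derivable_mxP dFij <-] := F1 t tab.
by rewrite derive_mx// mxE; exact: DeriveDef.
Qed.

End MatrixCalculus.

Lemma subitv_derives_on (R : realType) (a b c d : R) (f df : R -> R) :
  a <= c -> d <= b -> derives_on a b f df -> derives_on c d f df.
Proof.
move=> ac db [cf f1]; split.
  apply: continuous_subspaceW cf => t /=; rewrite !in_itv/= => /andP[ct td].
  by rewrite (le_trans ac)// (le_trans td).
move=> t; rewrite in_itv/= => /andP[ct td]; apply: f1.
by rewrite in_itv/= (le_lt_trans ac)// (lt_le_trans td).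
Qed.

Lemma translate_derives_on (R : realType) (a b : R) (f df : R -> R) :
  derives_on a b f df ->
  derives_on 0 (b - a) (fun t => f (a + t)) (fun t => df (a + t)).
Proof.
move=> [/subspace_continuousP cf f1]; split.
  apply/subspace_continuousP => t; rewrite /= in_itv/= => /andP[t0 tb].
  have abt : `[a, b]%classic (a + t).
    by rewrite /= in_itv/= lerDl t0/= -lerBrDl.
  apply: cvg_trans (cf _ abt) => A [e/= e0 Ae].
  exists e => //= y tey; rewrite in_itv/= => /andP[y0 yb].
  apply: Ae; first by rewrite /= opprD addrACA subrr add0r.
  by rewrite /= in_itv/= lerDl y0/= -lerBrDl.
move=> t; rewrite in_itv/= => /andP[t0 tb].
have abt : a + t \in `]a, b[ by rewrite in_itv/= ltrDl t0/= -ltrBrDl.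
have sd : is_derive t 1 (fun u : R => a + u) (1 : R).
  rewrite (_ : (fun u => _) = shift a); last by apply/funext => u; rewrite addrC.
  exact: is_derive_shift.
by apply: (is_derive_eq (@is_derive1_comp _ f _ _ _ _ (f1 _ abt) sd)); rewrite mulr1.
Qed.

(** * One-sided derivatives at the endpoints *)

Section DerivableWithin.
Variables (R : realType) (V : normedModType R).
Implicit Types (D : set R) (f : R -> V) (x : R).

(** The increment [f y - f x] is [y - x], which tends to [0], times a difference
quotient that converges. *)
Lemma derivable_within_cvg D f x : D x -> derivable_within D f x ->
  f @ within D (nbhs x) --> f x.
Proof.
move=> Dx dfx.
have f_cvg : f @ within D x^' --> f x.
  have id_cvg : y @[y --> within D x^'] --> x.
    exact: cvg_trans (cvg_within _) (cvg_within _).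
  have sub_cvg : (y - x) @[y --> within D x^'] --> (0 : R).
    by rewrite -(subrr x); exact: cvgB id_cvg (cvg_cst x).
  have FF : Filter (within D x^') by exact: within_filter.
  have fx := @cvgD _ _ _ _ FF _ _ _ _ (cvgZ sub_cvg dfx) (cvg_cst (f x)).
  rewrite scale0r add0r in fx; apply: cvg_trans (fx FF FF); apply: near_eq_cvg.
  rewrite near_withinE; near=> y => Dy /=.
  rewrite fctE scalerA divff ?scale1r ?subrK//.
  by rewrite subr_eq0; near: y; exact: nbhs_dnbhs_neq.
move=> A fxA; have := f_cvg A fxA.
rewrite /nbhs/= /within/= => nA; near=> y => Dy.
have [->|yx] := eqVneq y x; first exact: nbhs_singleton.
by move: yx Dy; near: y.
Unshelve. all: by end_near. Qed.

(** When [D] is a neighbourhood of [x], restricting the difference quotient to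
[D] does not change its limit; only the change of variable [y = h + x] is left. *)
Lemma derivable_within_is_derive D f x : nbhs x D -> derivable_within D f x ->
  is_derive x (1 : R) f (derive_within D f x).
Proof.
move=> nD dfx.
have shift_cvg : (h + x) @[h --> 0^'] --> within D x^'.
  have cxh : (h + x) @[h --> (0 : R)] --> x.
    by rewrite -[X in _ --> X]add0r; exact: cvgD cvg_id (cvg_cst x).
  move=> A; rewrite /nbhs/= /within/= => nA.
  apply: (filterS (F := nbhs (0 : R)) _ (cxh _ (filterI nD nA))) => h.
  move=> [/= Dhx Ahx] h0; apply: Ahx => //.
  by rewrite -subr_eq0 addrK.
have fD : h^-1 *: ((f \o shift x) (h *: 1) - f x) @[h --> 0^'] -->
    derive_within D f x.
  have q_cvg : (y - x)^-1 *: (f y - f x) @[y --> within D x^'] -->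
    derive_within D f x by exact: dfx.
  apply: cvg_trans (cvg_comp _ _ shift_cvg q_cvg); apply: near_eq_cvg; near=> h => /=.
  by rewrite addrK /GRing.scale/= mulr1.
split; first by apply/cvg_ex; exists (derive_within D f x).
exact: cvg_lim.
Unshelve. all: by end_near. Qed.

End DerivableWithin.

Lemma derivable_within_mx_derives_on (R : realType) (a b : R) m p
    (F : R -> 'M[R]_(m, p)) :
  (forall t, t \in `[a, b] -> derivable_within `[a, b] F t) ->
  mx_derives_on a b F (derive_within `[a, b] F).
Proof.
move=> dF; apply: mx_derives_on_intro.
  apply/subspace_continuousP => t abt.
  exact: derivable_within_cvg (dF t abt).
move=> t tab; apply: derivable_within_is_derive.
  apply: filterS (near_in_itvoo tab) => y.
  exact: subset_itv_oo_cc.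
by apply: dF; exact: subset_itv_oo_cc tab.
Qed.

(** * Quadratic forms *)

Section QuadraticForms.
Variable R : realType.

Definition qform m (M : 'M[R]_m) (v : 'cV[R]_m) : R := (v^T *m M *m v) 0 0.

Definition sqnorm m (v : 'cV[R]_m) : R := qform 1%:M v.

(** A crude norm is enough: its powers only have to bound the entries of the
powers of [M], and it has to bound the quadratic form of [M]. *)
Definition mx_l1norm m (M : 'M[R]_m) : R := \sum_i \sum_j `|M i j|.

Section Forms.
Variable m : nat.
Implicit Types (M : 'M[R]_m) (v w : 'cV[R]_m).

Lemma qformD M1 M2 v : qform (M1 + M2) v = qform M1 v + qform M2 v.
Proof. by rewrite /qform mulmxDr mulmxDl mxE. Qed.

Lemma qform0 v : qform 0 v = 0.
Proof. by rewrite /qform mulmx0 mul0mx mxE. Qed.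

Lemma qformN M v : qform (- M) v = - qform M v.
Proof. by rewrite /qform mulmxN mulNmx mxE. Qed.

Lemma qformZ c M v : qform (c *: M) v = c * qform M v.
Proof. by rewrite /qform -scalemxAr -scalemxAl mxE. Qed.

Lemma qform_scalar c v : qform c%:M v = c * sqnorm v.
Proof. by rewrite /sqnorm -qformZ scale_scalar_mx mulr1. Qed.

Lemma qform_congr p (B : 'M[R]_(m, p)) M (v : 'cV[R]_p) :
  qform (B^T *m M *m B) v = qform M (B *m v).
Proof. by rewrite /qform trmx_mul !mulmxA. Qed.

Lemma sqnormE v : sqnorm v = \sum_i v i 0 ^+ 2.
Proof.
rewrite /sqnorm /qform mulmx1 mxE; apply: eq_bigr => i _.
by rewrite mxE expr2.
Qed.

Lemma sqr_entry_le_sqnorm v i : v i 0 ^+ 2 <= sqnorm v.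
Proof.
by rewrite sqnormE (bigD1 i)//= lerDl sumr_ge0// => j _; exact: sqr_ge0.
Qed.

Lemma sqnorm_ge0 v : 0 <= sqnorm v.
Proof. by rewrite sqnormE sumr_ge0// => i _; exact: sqr_ge0. Qed.

Lemma sqnorm_gt0 v : v != 0 -> 0 < sqnorm v.
Proof.
move=> v0; rewrite lt0r sqnorm_ge0 andbT; apply: contra v0 => /eqP v0.
apply/eqP/colP => i; rewrite mxE; apply/eqP.
by rewrite -sqrf_eq0 eq_le sqr_ge0 -v0 sqr_entry_le_sqnorm.
Qed.

Lemma posdefmx_qform_ge0 M v : posdefmx M -> 0 <= qform M v.
Proof.
move=> [_ M0]; have [->|/M0/ltW//] := eqVneq v 0.
by rewrite /qform mulmx0 mxE.
Qed.

Lemma mx_l1norm_ge0 M : 0 <= mx_l1norm M.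
Proof. by rewrite !sumr_ge0// => i _; rewrite sumr_ge0. Qed.

(** The absolute value of each coordinate of [v] is at most the square root of
[sqnorm v], so that of a product of two coordinates is at most [sqnorm v]. *)
Lemma qform_le_l1norm M v : qform M v <= mx_l1norm M * sqnorm v.
Proof.
rewrite /qform mxE /mx_l1norm exchange_big mulr_suml; apply: ler_sum => j _ /=.
rewrite mxE !mulr_suml; apply: ler_sum => i _.
rewrite mxE mulrAC (mulrC _ (M i j)); apply: (le_trans (ler_norm _)).
rewrite normrM ler_wpM2l//.
have := sqr_entry_le_sqnorm v i; have := sqr_entry_le_sqnorm v j.
rewrite -(real_normK (num_real (v i 0))) -(real_normK (num_real (v j 0))) normrM.
by move=> vi vj; nra.
Qed.

(** This bound and [sqnorm_le_sqr_norm] compare the norm of the space of vectors,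
which is the maximum norm, with the Euclidean one used in the estimates. *)
Lemma sqr_norm_le_sqnorm v : `|v| ^+ 2 <= sqnorm v.
Proof.
rewrite -[sqnorm v]sqr_sqrtr ?sqnorm_ge0// ler_sqr ?nnegrE ?sqrtr_ge0//.
rewrite [leLHS]/Num.Def.normr/= mx_normrE; apply: bigmax_le => [|[i j] _ /=].
  exact: sqrtr_ge0.
by rewrite ord1 -sqrtr_sqr ler_sqrt ?sqnorm_ge0// sqr_entry_le_sqnorm.
Qed.

Lemma sqnorm_le_sqr_norm v : sqnorm v <= m%:R * `|v| ^+ 2.
Proof.
rewrite sqnormE mulr_natl -[X in _ *+ X]card_ord -sumr_const.
apply: ler_sum => i _; rewrite -(real_normK (num_real (v i 0))).
rewrite ler_sqr ?nnegrE// [leRHS]/Num.Def.normr/= mx_normrE.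
exact: (le_bigmax _ (fun ij => `|v ij.1 ij.2|) (i, 0)).
Qed.

End Forms.
End QuadraticForms.

(** * The looped-functional inequality *)

(** Symmetry of [M t] merges the two terms that differentiate [v] into a single
[symsum]. *)
Lemma qform_derives_on (R : realType) (a b : R) m (M dM : R -> 'M[R]_m)
    (B : 'M[R]_m) (v : R -> 'cV[R]_m) :
  mx_derives_on a b M dM ->
  (forall t, t \in `]a, b[ -> (M t)^T = M t) ->
  mx_derives_on a b v (fun t => B *m v t) ->
  derives_on a b (fun t => qform (M t) (v t))
    (fun t => qform (symsum (M t *m B) + dM t) (v t)).
Proof.
move=> MdM Msym vdv.
have := mx_derives_onM (mx_derives_onM (mx_derives_on_tr vdv) MdM) vdv.
move=> /(_ 0 0); apply: eq_derives_on => t tab.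
rewrite /qform /symsum !trmx_mul Msym// !mulmxDr !mulmxDl !mulmxA.
by rewrite !mxE; ring.
Qed.

Lemma qform_diag3 (R : realType) n (M1 M2 M3 : 'M[R]_n) (v1 v2 v3 : 'cV[R]_n) :
  qform (diag3 M1 M2 M3) (col_mx v1 (col_mx v2 v3)) =
  qform M1 v1 + qform M2 v2 + qform M3 v3.
Proof.
rewrite /qform /diag3 !tr_col_mx !(mul_row_block, mul_row_col).
by rewrite !mulmx0 !addr0 !add0r mul_row_col !mxE addrA.
Qed.

Section LoopedFunctional.
Variables (R : realType) (n : nat).
Implicit Types (A P Q : 'M[R]_n) (x : R -> 'cV[R]_n).

(** [Y1] and [Y2] send the pair [(x 0, x T)] to the values at [0] and at [T] of
the path [(x t, x 0, x T)]. *)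
Lemma Y1_col (u v : 'cV[R]_n) :
  Y1 R n *m col_mx u v = col_mx u (col_mx u v).
Proof.
by rewrite /Y1 !(mul_col_mx, mul_row_col) !mul1mx !mul0mx !addr0 add0r.
Qed.

Lemma Y2_col (u v : 'cV[R]_n) :
  Y2 R n *m col_mx u v = col_mx v (col_mx u v).
Proof.
by rewrite /Y2 !(mul_col_mx, mul_row_col) !mul1mx !mul0mx !addr0 !add0r.
Qed.

(** The functional of the introduction is nonincreasing and its [Z]
term takes equal values at [0] and [T]; what remains is [T] times the claim. *)
Lemma dwell_decrease A P Q (eps T Tm : R) (Z : R -> 'M[R]_(n + (n + n))) x :
  0 < T <= Tm -> P^T = P ->
  (forall t, t \in `[0, Tm] -> (Z t)^T = Z t) ->
  (forall t, t \in `[0, Tm] -> derivable_within `[0, Tm] Z t) ->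
  (Y2 R n)^T *m Z T *m Y2 R n - (Y1 R n)^T *m Z 0 *m Y1 R n = 0 ->
  (forall t, t \in `[0, T] ->
    Psi A P Q eps T + symsum (Z t *m diag3 A 0 0)
      + derive_within `[0, Tm] Z t \preceq 0) ->
  mx_derives_on 0 T x (fun t => A *m x t) ->
  qform P (x T) <= qform Q (x 0) - eps * sqnorm (x 0).
Proof.
move=> /andP[T_gt0 TTm] Psym Zsym Zder bnd LMI xA.
pose xi t := col_mx (x t) (col_mx (x 0) (x T)).
have xiA : mx_derives_on 0 T xi (fun t => diag3 A 0 0 *m xi t).
  have := mx_derives_on_col xA (mx_derives_on_cst 0 T (col_mx (x 0) (x T))).
  apply: eq_mx_derives_on => t _.
  rewrite /diag3 /xi mul_block_col !mul0mx addr0 add0r.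
  by rewrite mul_block_col !mul0mx addr0 col_mx0.
have ZdZ : mx_derives_on 0 T Z (derive_within `[0, Tm] Z).
  move=> i j; apply: subitv_derives_on (lexx 0) TTm _.
  exact: derivable_within_mx_derives_on Zder i j.
have inTm t : t \in `]0, T[ -> t \in `[0, Tm].
  rewrite !in_itv/= => /andP[t0 tT].
  by rewrite (ltW t0) (le_trans (ltW tT)).
have xiZ := qform_derives_on ZdZ (fun t tT => Zsym t (inTm t tT)) xiA.
have xP := qform_derives_on (mx_derives_on_cst 0 T P) (fun _ _ => Psym) xA.
have id_der : derives_on 0 T (fun t : R => t) (fun=> 1).
  by apply: derives_on_everywhere => t; exact: is_derive_id.
pose c := qform (P - Q + eps%:M) (x 0).
have g_der := derives_onD (derives_onD
  (derives_onM (derives_on_cst 0 T T) xP)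
  (derives_onM id_der (derives_on_cst 0 T c))) xiZ.
have boundary : qform (Z T) (xi T) = qform (Z 0) (xi 0).
  apply/eqP; rewrite -subr_eq0 /xi -Y2_col -Y1_col -!qform_congr -qformN -qformD.
  by rewrite bnd /qform mulmx0 mul0mx mxE.
have cE : c = qform P (x 0) - qform Q (x 0) + eps * sqnorm (x 0).
  by rewrite /c !qformD qformN qform_scalar.
have := derives_on_nonincreasing (ltW T_gt0) g_der; rewrite /= boundary cE.
move=> /(_ _)/wrap[t tT|g_le]; last by nra.
have tT' : t \in `[0, T] by exact: subset_itv_oo_cc tT.
have [_ /(_ (xi t))] := LMI t tT'; rewrite -/(qform _ _) -cE.
rewrite sub0r qformN oppr_ge0 !qformD /Psi qform_diag3 => Psi_le.
move: Psi_le; rewrite -/c !qform0 (trmx_mul P) Psym qformZ qformD; lra.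
Qed.

End LoopedFunctional.

(** * The matrix exponential *)

Lemma cvg_mx (R : realType) (T : Type) (F : set_system T) m p
    (f : T -> 'M[R]_(m, p)) (M : 'M[R]_(m, p)) : Filter F ->
  (forall i j, f t i j @[t --> F] --> M i j) -> f @ F --> M.
Proof.
move=> FF fM; apply/cvgrPdist_le => e e0; near=> t.
rewrite [leLHS]/Num.Def.normr/= mx_normrE; apply: bigmax_le => [|ij _].
  exact: ltW.
rewrite !mxE; move: ij; near: t; apply: filter_forall => ij.
by move/cvgrPdist_le : (fM ij.1 ij.2); exact.
Unshelve. all: by end_near. Qed.

Section MatrixExponential.
Variables (R : realType) (n : nat).
Implicit Types (M : 'M[R]_n) (t : R).

Lemma exprmxZ t M k : (t *: M) ^+ k = t ^+ k *: M ^+ k.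
Proof.
elim: k => [|k IH]; first by rewrite !expr0 scale1r.
rewrite exprS IH exprS exprS -[_ * _]/(_ *m _).
by rewrite -scalemxAl -scalemxAr scalerA.
Qed.

Lemma trmxX M k : (M ^+ k)^T = M^T ^+ k.
Proof.
elim: k => [|k IH]; first by rewrite !expr0 trmx1.
by rewrite exprS exprSr trmx_mul IH.
Qed.

Lemma exprmx_entry_le M k i j : `|(M ^+ k) i j| <= mx_l1norm M ^+ k.
Proof.
elim: k i j => [|k IH] i j.
  by rewrite !expr0 mxE; case: (i == j); rewrite ?normr1 ?normr0.
rewrite !exprS mxE (le_trans (ler_norm_sum _ _ _))//.
have row_le : \sum_l `|M i l| <= mx_l1norm M.
  rewrite [leRHS](bigD1 i)//= lerDl sumr_ge0// => l _; exact: sumr_ge0.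
have c_ge0 : 0 <= mx_l1norm M ^+ k by rewrite exprn_ge0// mx_l1norm_ge0.
apply: le_trans (ler_wpM2r c_ge0 row_le); rewrite mulr_suml.
by apply: ler_sum => l _; rewrite normrM ler_wpM2l.
Qed.

(** Coefficients of the power series in [t] of the [(i, j)] entry of
[M ^+ m * exp (t M)].  The shift [m] makes the family stable under
[pseries_diffs]. *)
Definition expmx_coeff M m i j (k : nat) : R := (k`!%:R)^-1 * (M ^+ (k + m)) i j.

(** With [c = mx_l1norm M], the series is dominated by [c ^+ m] times that of
[exp (c |t|)]. *)
Lemma is_cvg_expmx_coeff M m i j t :
  cvgn (pseries (expmx_coeff M m i j) t).
Proof.
apply: normed_cvg; set c := mx_l1norm M; have c0 : 0 <= c := mx_l1norm_ge0 M.
apply: (series_le_cvg (v_ := fun k => c ^+ m * exp_coeff (c * `|t|) k)) => [k|k|k|].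
- exact: normr_ge0.
- by apply: mulr_ge0; rewrite ?exp_coeff_ge0 ?exprn_ge0 ?mulr_ge0.
- rewrite /expmx_coeff /exp_coeff /= !normrM normrX ger0_norm ?invr_ge0// exprMn.
  have := exprmx_entry_le M (k + m) i j; rewrite -/c => h.
  rewrite [leRHS](_ : _ = (k`!%:R)^-1 * c ^+ (k + m) * `|t| ^+ k); last first.
    by rewrite exprD; ring.
  by rewrite ler_wpM2r ?exprn_ge0// ler_wpM2l ?invr_ge0.
- rewrite (_ : series _ = c ^+ m *: series (exp_coeff (c * `|t|))).
    by apply: is_cvgZr; exact: is_cvg_series_exp_coeff.
  by apply/funext => N; rewrite /series/= fctE /GRing.scale/= mulr_sumr.
Qed.

Lemma pseries_diffs_expmx_coeff M m i j :
  pseries_diffs (expmx_coeff M m i j) = expmx_coeff M m.+1 i j.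
Proof.
apply/funext => k; rewrite /pseries_diffs /expmx_coeff factS natrM invfM addnS.
by rewrite -!mulrA mulVKf// addSn.
Qed.

Lemma series_expmx_entry M t N i j :
  series (fun k => (k`!%:R)^-1 *: (t *: M) ^+ k) N i j =
  pseries (expmx_coeff M 0 i j) t N.
Proof.
rewrite /pseries /series/= summxE; apply: eq_bigr => k _.
by rewrite exprmxZ !mxE /expmx_coeff addn0 mulrAC mulrA.
Qed.

Lemma expmx_cvg M t :
  series (fun k => (k`!%:R)^-1 *: (t *: M) ^+ k) @ \oo --> expmx (t *: M).
Proof.
suff [L S_L] : exists L : 'M[R]_n,
    series (fun k => (k`!%:R)^-1 *: (t *: M) ^+ k) @ \oo --> L.
  by apply/cvg_ex; exists L.
exists (\matrix_(i, j) limn (pseries (expmx_coeff M 0 i j) t)).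
apply: cvg_mx => i j; rewrite mxE; under eq_fun do rewrite series_expmx_entry.
exact: is_cvg_expmx_coeff.
Qed.

Lemma expmx_entry M t i j :
  expmx (t *: M) i j = limn (pseries (expmx_coeff M 0 i j) t).
Proof.
apply/esym/cvg_lim => //.
apply: cvg_trans (cvg_comp _ _ (@expmx_cvg M t) (@coord_continuous _ _ _ i j _)).
by apply: near_eq_cvg; apply: nearW => N /=; rewrite series_expmx_entry.
Qed.

Lemma mul_expmx_entry M t i j :
  (M *m expmx (t *: M)) i j = limn (pseries (expmx_coeff M 1 i j) t).
Proof.
apply/esym/cvg_lim => //; rewrite mxE.
rewrite (_ : pseries _ t =
  fun N => \sum_l M i l * pseries (expmx_coeff M 0 l j) t N).
  apply: cvg_big => [|l _]; first exact: add_continuous.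
  rewrite expmx_entry; apply: cvgM; first exact: cvg_cst.
  exact: is_cvg_expmx_coeff.
apply/funext => N; rewrite /pseries /series/=.
under [RHS]eq_bigr do rewrite mulr_sumr.
rewrite exchange_big; apply: eq_bigr => k _.
rewrite /expmx_coeff addn1 exprS mxE mulr_sumr mulr_suml.
by apply: eq_bigr => l _; rewrite addn0; ring.
Qed.

(** Termwise differentiation of a power series at [t] needs convergence at a
point of larger modulus, here [|t| + 1]; the series converges everywhere. *)
Lemma expmx_derives_on M a b :
  mx_derives_on a b (fun t => expmx (t *: M)) (fun t => M *m expmx (t *: M)).
Proof.
move=> i j; apply: derives_on_everywhere => t.
under eq_fun do rewrite expmx_entry.
rewrite mul_expmx_entry -pseries_diffs_expmx_coeff.
apply: (@pseries_snd_diffs _ _ (`|t| + 1)); rewrite ?pseries_diffs_expmx_coeff.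
- exact: is_cvg_expmx_coeff.
- exact: is_cvg_expmx_coeff.
- exact: is_cvg_expmx_coeff.
- by rewrite [ltRHS]ger0_norm ?addr_ge0// ltrDl.
Qed.

Lemma expmx0 : expmx (0 : 'M[R]_n) = 1%:M.
Proof.
apply/cvg_lim => //; apply: cvg_mx => i j.
apply: cvg_near_cst; exists 1%N => // -[//|N] _ /=.
rewrite /series/= big_nat_recl//= big1_seq => [|k _].
  by rewrite addr0 expr0 fact0 invr1 scale1r.
by rewrite exprS mul0r scaler0.
Qed.

Lemma trmx_expmx M t : (expmx (t *: M))^T = expmx (t *: M^T).
Proof.
apply/matrixP => i j; rewrite mxE !expmx_entry; congr (limn (pseries _ _)).
by apply/funext => k; rewrite /expmx_coeff !addn0 -trmxX mxE.
Qed.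

End MatrixExponential.

(** * Decay and growth along one mode *)

(** The columns of [exp (t A)] are solutions, so the decrease of quadratic forms
along solutions is an inequality between matrices. *)
Lemma expmx_sandwich_lt (R : realType) n (A P Q : 'M[R]_n) (eps T : R) :
  0 < eps -> P^T = P -> Q^T = Q ->
  (forall x : R -> 'cV[R]_n, mx_derives_on 0 T x (fun t => A *m x t) ->
    qform P (x T) <= qform Q (x 0) - eps * sqnorm (x 0)) ->
  expmx (T *: A^T) *m P *m expmx (T *: A) - Q \prec 0.
Proof.
move=> eps_gt0 Psym Qsym decr; rewrite -trmx_expmx; split.
  by rewrite !linearB/= trmx0 !trmx_mul trmxK Psym Qsym mulmxA.
move=> v v0; rewrite -/(qform _ _) sub0r qformN qformD qformN qform_congr.
have xder : mx_derives_on 0 T (fun t => expmx (t *: A) *m v)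
    (fun t => A *m (expmx (t *: A) *m v)).
  have := mx_derives_onM (expmx_derives_on A 0 T) (mx_derives_on_cst 0 T v).
  by apply: eq_mx_derives_on => t _; rewrite mulmx0 addr0 mulmxA.
have := decr _ xder; rewrite scale0r expmx0 mul1mx.
by have := mulr_gt0 eps_gt0 (sqnorm_gt0 v0); lra.
Qed.

(** A Gronwall estimate: the derivative of [|x|^2] is [x^T (A + A^T) x], at most
[L |x|^2], so [exp (- L (t - a)) |x|^2] is nonincreasing. *)
Lemma sqnorm_growth (R : realType) n (A : 'M[R]_n) (a b : R)
    (x : R -> 'cV[R]_n) : a <= b ->
  mx_derives_on a b x (fun t => A *m x t) ->
  sqnorm (x b) <= expR (mx_l1norm (symsum A) * (b - a)) * sqnorm (x a).
Proof.
move=> ab xA; set L := mx_l1norm _.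
have E_der := qform_derives_on (mx_derives_on_cst a b 1%:M)
  (fun _ _ => trmx1 _ _) xA.
have exp_der : derives_on a b (fun t => expR (- L * (t - a)))
    (fun t => expR (- L * (t - a)) * - L).
  apply: derives_on_everywhere => t.
  have lin_der : is_derive t 1 (fun u : R => - L * (u - a)) (- L).
    apply: (is_derive_eq (is_deriveZ (- L)
      (is_deriveB (is_derive_id t (1 : R)) (is_derive_cst a t 1)))).
    by rewrite subr0 /GRing.scale/= mulr1.
  exact: is_derive1_comp (is_derive_expR _) lin_der.
have := derives_on_nonincreasing ab (derives_onM exp_der E_der).
rewrite subrr mulr0 expR0 mul1r mulNr expRN => decr.
rewrite -ler_pdivrMl ?expR_gt0//; apply: decr => t _.
rewrite mul1mx addr0.
have := qform_le_l1norm (symsum A) (x t); rewrite -/L -/(sqnorm _) => EL.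
by have := expR_gt0 (- L * (t - a)); nra.
Qed.

(** * Legs of a switching signal, and stability *)

Section SwitchingLegs.
Variables (R : realType) (N : nat) (sigma : R -> 'I_N) (s : nat -> R).
Hypothesis sw : switching_signal sigma s.

(** Leg [k] runs from [leg_start k] to [s k]; the initial sojourn is leg [0], so
that the mode entered at [s k] is the mode of leg [k.+1]. *)
Definition leg_start (k : nat) : R := if k is k'.+1 then s k' else 0.

Definition leg_mode (k : nat) : 'I_N := sigma (leg_start k).

Lemma switching_times_le k l : (k <= l)%N -> s k <= s l.
Proof.
move: k l; apply/nondecreasing_seqP => i.
exact/ltW/(switching_increasing sw).
Qed.

Lemma leg_start_ge0 k : 0 <= leg_start k.
Proof.
case: k => [|k] //=.
exact: le_trans (ltW (switching_first_gt0 sw)) (switching_times_le (leq0n k)).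
Qed.

Lemma leg_mode_on k t : leg_start k <= t -> t < s k -> sigma t = leg_mode k.
Proof.
by case: k => [|k]; [exact: (switching_initial_mode sw) | exact: (switching_mode sw)].
Qed.

Lemma leg_mode_change k : leg_mode k.+1 != leg_mode k.
Proof.
by case: k => [|k]; [exact: (switching_initial_change sw) | exact: (switching_change sw)].
Qed.

(** The first switching instant after [t] ends the leg of [t]; it exists because
switching instants do not accumulate. *)
Lemma leg_cover t : 0 <= t -> exists2 k, leg_start k <= t & t < s k.
Proof.
move=> t0.
have ex_s : exists k, t < s k.
  have /cvgryPgt s_gt := switching_no_accumulation sw.
  have [k _ sk] := s_gt t.
  by exists k; exact: sk (leqnn k).
case: (ex_minnP ex_s) => k tk k_min; exists k => //.
case: k tk k_min => [//|k] _ k_min /=; rewrite leNgt; apply/negP => /k_min.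
by rewrite ltnn.
Qed.

Lemma leg_cover_after K t : s K <= t ->
  exists k, [/\ (K <= k)%N, s k <= t & t <= s k.+1].
Proof.
move=> Kt.
have /leg_cover[k kt tk] : 0 <= t := le_trans (leg_start_ge0 K.+1) Kt.
have Kk : (K < k)%N.
  rewrite ltnNge; apply/negP => /switching_times_le skK.
  by have := lt_le_trans tk (le_trans skK Kt); rewrite ltxx.
by case: k Kk kt tk => // k Kk kt tk; exists k; split=> //; exact: ltW.
Qed.

(** No switching instant lies strictly inside a leg, so the switched equation
is there the linear equation of a single mode. *)
Lemma solution_on_leg n (A : 'I_N -> 'M[R]_n) t0 (x : R -> 'cV[R]_n) k a b :
  switched_solution A sigma s t0 x -> t0 <= a -> leg_start k <= a -> b <= s k ->
  mx_derives_on a b x (fun t => A (leg_mode k) *m x t).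
Proof.
move=> [xcont xder] t0a ka bk; apply: mx_derives_on_intro.
  apply: continuous_subspaceW xcont => t /=; rewrite !in_itv/= andbT.
  by move=> /andP[at_ _]; exact: le_trans t0a at_.
move=> t; rewrite in_itv/= => /andP[a_t t_b].
rewrite -(@leg_mode_on k t) ?(ltW (le_lt_trans ka a_t)) ?(lt_le_trans t_b)//.
apply: xder => [|l]; first exact: le_lt_trans t0a a_t.
have [kl|lk] := leqP k l.
  by rewrite lt_eqF// (lt_le_trans t_b)// (le_trans bk)// switching_times_le.
rewrite gt_eqF// (le_lt_trans _ a_t)// (le_trans _ ka)//.
by case: k lk {ka bk} => // k; rewrite ltnS; exact: switching_times_le.
Qed.

End SwitchingLegs.

(** From here on the matrix inequalities enter only through the decrease of [V]
from one switching instant to the next. *)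
Section LyapunovStability.
Variables (R : realType) (N n : nat) (A P : 'I_N -> 'M[R]_n).
Variables (sigma : R -> 'I_N) (s : nat -> R) (eps D : R).
Hypothesis eps_gt0 : 0 < eps.
Hypothesis Ppos : forall i, posdefmx (P i).
Hypothesis sw : switching_signal sigma s.
Hypothesis dwell_le : forall k, s k.+1 - s k <= D.

Local Notation mode := (leg_mode sigma s).

Hypothesis leg_decrease : forall k (x : R -> 'cV[R]_n),
  mx_derives_on (s k) (s k.+1) x (fun t => A (mode k.+1) *m x t) ->
  qform (P (mode k.+1)) (x (s k.+1)) <=
  qform (P (mode k)) (x (s k)) - eps * sqnorm (x (s k)).

Let rate : R := \sum_i mx_l1norm (symsum (A i)).
Let weight : R := \sum_i mx_l1norm (P i).
Let growth : R := expR (rate * D).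

Let rate_ge0 : 0 <= rate.
Proof. by apply: sumr_ge0 => i _; exact: mx_l1norm_ge0. Qed.

Let weight_ge0 : 0 <= weight.
Proof. by apply: sumr_ge0 => i _; exact: mx_l1norm_ge0. Qed.

Let qform_P_le i (v : 'cV[R]_n) : qform (P i) v <= weight * sqnorm v.
Proof.
apply: le_trans (qform_le_l1norm _ _) _.
rewrite ler_wpM2r ?sqnorm_ge0// /weight (bigD1 i)//= lerDl sumr_ge0// => j _.
exact: mx_l1norm_ge0.
Qed.

Section Solution.
Variables (t0 : R) (x : R -> 'cV[R]_n).
Hypothesis sol : switched_solution A sigma s t0 x.
Variable K : nat.
Hypotheses (K_t0 : leg_start s K <= t0) (t0_K : t0 < s K).

Let V k := qform (P (mode k)) (x (s k)).

Let s_ge_t0 k : (K <= k)%N -> t0 <= s k.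
Proof. by move=> Kk; exact: le_trans (ltW t0_K) (switching_times_le sw Kk). Qed.

Lemma leg_growth k a t : t0 <= a -> leg_start s k <= a -> a <= t -> t <= s k ->
  sqnorm (x t) <= expR (rate * (t - a)) * sqnorm (x a).
Proof.
move=> t0a ka a_t tk.
have xA := solution_on_leg sw sol t0a ka tk.
apply: le_trans (sqnorm_growth a_t xA) _.
rewrite ler_wpM2r ?sqnorm_ge0// ler_expR ler_wpM2r ?subr_ge0//.
rewrite /rate (bigD1 (mode k))//= lerDl sumr_ge0// => i _.
exact: mx_l1norm_ge0.
Qed.

Lemma sojourn_growth k t : (K <= k)%N -> s k <= t -> t <= s k.+1 ->
  sqnorm (x t) <= growth * sqnorm (x (s k)).
Proof.
move=> Kk kt tk; apply: le_trans (@leg_growth k.+1 _ _ (s_ge_t0 Kk) _ kt tk) _ => //.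
rewrite ler_wpM2r ?sqnorm_ge0// ler_expR ler_wpM2l//.
by rewrite (le_trans _ (dwell_le k))// lerB.
Qed.

Lemma lyapunov_decrease k : (K <= k)%N ->
  V k.+1 <= V k - eps * sqnorm (x (s k)).
Proof.
move=> Kk; apply: leg_decrease.
exact: (solution_on_leg sw sol (s_ge_t0 Kk)).
Qed.

Lemma lyapunov_ge0 k : 0 <= V k.
Proof. exact: posdefmx_qform_ge0. Qed.

Lemma lyapunov_nonincreasing k l : (K <= k)%N -> (k <= l)%N -> V l <= V k.
Proof.
move=> Kk; elim: l => [|l IH]; first by rewrite leqn0 => /eqP->.
rewrite leq_eqVlt => /predU1P[->//|]; rewrite ltnS => kl.
apply: le_trans (lyapunov_decrease (leq_trans Kk kl)) _.
apply: le_trans (IH kl); rewrite gerBl mulr_ge0 ?sqnorm_ge0//.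
exact: ltW.
Qed.

(** [V_(k+1) >= 0] turns the decrease at [k] into [eps |x(s_k)|^2 <= V_k], and
[V_k <= V_K]. *)
Lemma sqnorm_switch_le k : (K <= k)%N ->
  eps * sqnorm (x (s k)) <= weight * sqnorm (x (s K)).
Proof.
move=> Kk; have := lyapunov_decrease Kk; have := lyapunov_ge0 k.+1.
have := lyapunov_nonincreasing (leqnn K) Kk; have := qform_P_le (mode K) (x (s K)).
rewrite -/(V K); lra.
Qed.

(** The time before [s K] accounts for the exponential factor, the bound on the
switched states for [weight / eps], and the last sojourn for [growth]. *)
Lemma solution_sqnorm_le t : t0 <= t ->
  sqnorm (x t) <= (1 + growth * (weight / eps)) *
    expR (rate * (s K - t0)) * sqnorm (x t0).
Proof.
move=> t0t.
have factor_ge0 : 0 <= growth * (weight / eps).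
  by rewrite mulr_ge0 ?expR_ge0// divr_ge0// ltW.
have first_leg u : t0 <= u -> u <= s K ->
    sqnorm (x u) <= expR (rate * (s K - t0)) * sqnorm (x t0).
  move=> t0u uK; apply: le_trans (leg_growth (lexx t0) K_t0 t0u uK) _.
  by rewrite ler_wpM2r ?sqnorm_ge0// ler_expR ler_wpM2l// lerB.
have [tK|/ltW Kt] := leP t (s K).
  apply: le_trans (first_leg _ t0t tK) _; rewrite -mulrA ler_peMl//.
    by rewrite mulr_ge0 ?expR_ge0 ?sqnorm_ge0.
  by rewrite lerDl.
have [k [Kk kt tk]] := leg_cover_after sw Kt.
apply: le_trans (sojourn_growth Kk kt tk) _.
have switch_le : sqnorm (x (s k)) <= weight / eps * sqnorm (x (s K)).
  by rewrite mulrAC ler_pdivlMr// mulrC; exact: sqnorm_switch_le.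
apply: (@le_trans _ _ (growth * (weight / eps) * sqnorm (x (s K)))).
  by rewrite -mulrA ler_wpM2l// expR_ge0.
rewrite -[leRHS]mulrA.
apply: le_trans (ler_wpM2l factor_ge0 (first_leg _ (ltW t0_K) (lexx _))) _.
by rewrite ler_wpM2r ?lerDr// mulr_ge0 ?expR_ge0 ?sqnorm_ge0.
Qed.

(** [V] converges, being nonincreasing and nonnegative, so its consecutive gaps,
which dominate [eps |x(s_k)|^2], tend to [0]. *)
Lemma sqnorm_switch_cvg0 : sqnorm (x (s k)) @[k --> \oo] --> 0.
Proof.
rewrite -(cvg_shiftn K); pose u k := V (k + K)%N.
have u_cvg : cvgn u.
  apply: nonincreasing_is_cvgn => [k l kl|].
    by apply: lyapunov_nonincreasing; rewrite ?leq_addl ?leq_add2r.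
  by exists 0 => _ [k _ <-]; exact: lyapunov_ge0.
have gap_cvg : (u k - u k.+1) / eps @[k --> \oo] --> 0.
  rewrite -(mul0r eps^-1) -(subrr (limn u)); apply: cvgM; last exact: cvg_cst.
  by apply: cvgB => //; rewrite (cvg_shiftS u).
apply: squeeze_cvgr (cvg_cst 0) gap_cvg; apply: nearW => k.
rewrite sqnorm_ge0 ler_pdivlMr// mulrC.
by have := lyapunov_decrease (leq_addl k K); rewrite /u addSn /=; lra.
Qed.

(** Every large time lies within a sojourn that starts at a late switching
instant, and the growth over one sojourn is bounded. *)
Lemma solution_cvg0 : x t @[t --> +oo] --> (0 : 'cV[R]_n).
Proof.
apply/cvgr0Pnorm_lt => e e0.
have eg_gt0 : 0 < e ^+ 2 / growth by rewrite divr_gt0 ?exprn_gt0 ?expR_gt0.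
have /cvgr0Pnorm_lt switch_small := sqnorm_switch_cvg0.
have [M _ M_small] := switch_small _ eg_gt0.
near=> t.
have Kt : s (maxn K M) <= t by near: t; by apply: nbhs_pinfty_ge; exact: num_real.
have [k [KMk kt tk]] := leg_cover_after sw Kt.
move: KMk; rewrite geq_max => /andP[Kk Mk].
rewrite -(ltr_sqr (normr_ge0 _) (ltW e0)).
apply: le_lt_trans (sqr_norm_le_sqnorm _) _.
apply: le_lt_trans (sojourn_growth Kk kt tk) _.
rewrite mulrC -ltr_pdivlMr ?expR_gt0//.
by have := M_small k Mk; rewrite /= ger0_norm// sqnorm_ge0.
Unshelve. all: by end_near. Qed.

End Solution.

Lemma leg_decrease_gas : globally_asymptotically_stable A sigma s.
Proof.
split=> t0 t0_ge0; have [K K_t0 t0_K] := leg_cover sw t0_ge0.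
  move=> e e0.
  pose c := (1 + growth * (weight / eps)) * expR (rate * (s K - t0)).
  have c_ge1 : 1 <= c.
    rewrite -[leLHS]mulr1 ler_pM// ?lerDl.
      by rewrite mulr_ge0 ?expR_ge0// divr_ge0// ltW.
    by rewrite -expR0 ler_expR mulr_ge0// subr_ge0 ltW.
  (* [|x t|^2 <= c |x t0|_2^2 <= c n |x t0|^2 <= B^2 |x t0|^2] with [B >= 1];
     [n.+1] instead of [n] keeps [B] positive in dimension [0]. *)
  pose B := n.+1%:R * c.
  have B_ge1 : 1 <= B by rewrite -[leLHS]mulr1 ler_pM// ler1n.
  have B_gt0 : 0 < B := lt_le_trans ltr01 B_ge1.
  exists (e / B); first exact: divr_gt0.
  move=> x sol xt0 t t0t; rewrite ltr_pdivlMr// mulrC in xt0.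
  apply: le_lt_trans xt0.
  rewrite -ler_sqr ?nnegrE ?(mulr_ge0 (ltW B_gt0))//.
  apply: le_trans (sqr_norm_le_sqnorm _) _.
  apply: le_trans (solution_sqnorm_le sol K_t0 t0_K t0t) _; rewrite -/c.
  apply: le_trans (ler_wpM2l (le_trans ler01 c_ge1) (sqnorm_le_sqr_norm _)) _.
  rewrite exprMn mulrA ler_wpM2r ?sqr_ge0// mulrC.
  apply: (@le_trans _ _ B); last by rewrite expr2 ler_peMl// ltW.
  by rewrite ler_wpM2r ?(le_trans ler01 c_ge1)// ler_nat.
by move=> x sol; exact: (solution_cvg0 sol t0_K).
Qed.

End LyapunovStability.

(** * Stability from the matrix inequalities *)

Theorem theorem11 (R : realType) (N n : nat) (A : 'I_N -> 'M[R]_n)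
    (Tmin Tmax : 'I_N -> R) (eps0 : R) (eps0_gt0 : 0 < eps0)
    (Tbounds : forall i : 'I_N, eps0 < Tmin i /\ Tmin i < Tmax i)
    (eps : R) (eps_gt0 : 0 < eps)
    (P : 'I_N -> 'M[R]_n) (Ppos : forall i : 'I_N, posdefmx (P i))
    (Z : 'I_N -> 'I_N -> R -> R -> 'M[R]_(n + (n + n)))
    (Zsym : forall i j : 'I_N, i != j -> forall tau T : R,
      tau \in `[0, Tmax i] -> T \in `[Tmin i, Tmax i] ->
      (Z i j tau T)^T = Z i j tau T)
    (Zderivable : forall i j : 'I_N, i != j -> forall tau T : R,
      tau \in `[0, Tmax i] -> T \in `[Tmin i, Tmax i] ->
      derivable_within `[0, Tmax i] (fun u : R => Z i j u T) tau)
    (Zboundary : forall i j : 'I_N, i != j -> forall T : R,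
      T \in `[Tmin i, Tmax i] ->
      (Y2 R n)^T *m Z i j T T *m Y2 R n - (Y1 R n)^T *m Z i j 0 T *m Y1 R n = 0)
    (LMI : forall i j : 'I_N, i != j -> forall tau T : R,
      tau \in `[0, T] -> T \in `[Tmin i, Tmax i] ->
      Psi (A i) (P i) (P j) eps T
      + symsum (Z i j tau T *m diag3 (A i) 0 0)
      + derive_within `[0, Tmax i] (fun u : R => Z i j u T) tau \preceq 0) :
  (forall (sigma : R -> 'I_N) (s : nat -> R),
     switching_signal sigma s ->
     mode_dependent_dwell_times Tmin Tmax sigma s ->
     globally_asymptotically_stable A sigma s) /\
  (forall i j : 'I_N, i != j -> forall T : R, T \in `[Tmin i, Tmax i] ->
     expmx (T *: (A i)^T) *m P i *m expmx (T *: A i) - P j \prec 0).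
Proof.
have decrease i j : i != j -> forall T, T \in `[Tmin i, Tmax i] ->
    forall x : R -> 'cV[R]_n, mx_derives_on 0 T x (fun t => A i *m x t) ->
    qform (P i) (x T) <= qform (P j) (x 0) - eps * sqnorm (x 0).
  move=> ij T T_in x xA.
  have /andP[T_ge T_le] : Tmin i <= T <= Tmax i by move: T_in; rewrite in_itv.
  have T_gt0 : 0 < T.
    exact: lt_le_trans (lt_trans eps0_gt0 (proj1 (Tbounds i))) T_ge.
  apply: (@dwell_decrease _ _ _ _ _ _ T (Tmax i) (Z i j ^~ T)) xA.
  - by rewrite T_gt0.
  - by have [] := Ppos i.
  - by move=> t t_in; exact: Zsym.
  - by move=> t t_in; exact: Zderivable.
  - exact: Zboundary.
  - by move=> t t_in; exact: LMI.
split=> [sigma s sw dwell|i j ij T T_in].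
  (* The sum of the bounds serves as a common bound for all modes. *)
  have dwell_le k : s k.+1 - s k <= \sum_i Tmax i.
    have [_ /le_trans] := dwell k; apply; rewrite (bigD1 (sigma (s k)))//= lerDl.
    rewrite sumr_ge0// => i _; have [Tmin_gt Tmax_gt] := Tbounds i.
    exact/ltW/(lt_trans eps0_gt0)/(lt_trans Tmin_gt).
  apply: (leg_decrease_gas eps_gt0 Ppos sw dwell_le) => k x xA.
  (* [decrease] is used with the mode entered at [s k] as [i], the mode left
     there as [j], and time counted from [s k]. *)
  have T_in : s k.+1 - s k \in `[Tmin (sigma (s k)), Tmax (sigma (s k))].
    by have [Tge Tle] := dwell k; rewrite in_itv/= Tge.
  have yA : mx_derives_on 0 (s k.+1 - s k) (fun t => x (s k + t))
      (fun t => A (sigma (s k)) *m x (s k + t)).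
    by move=> i j; exact: translate_derives_on (xA i j).
  have := decrease _ _ (leg_mode_change sw k) _ T_in _ yA.
  by rewrite addr0 subrKC.
have [Psym _] := Ppos i; have [Qsym _] := Ppos j.
exact: expmx_sandwich_lt eps_gt0 Psym Qsym (decrease i j ij T T_in).
Qed.
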